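(* Let $H$ be Hall's universal locally finite group. For every countable locally finite group $G$ there exist a subgroup $G' \leq H$ with $G' \cong G$ and a map $Aut(G') \to Aut(H)$, $f \mapsto \hat{f}$, such that for every $f \in Aut(G')$ the automorphism $\hat{f}$ of $H$ extends $f$ (i.e. $\hat{f}(x) = f(x)$ for all $x \in G'$), and the map $f \mapsto \hat{f}$ is an embedding of groups (an injective homomorphism) of $Aut(G')$ into $Aut(H)$.
   Context: Hall's universal locally finite group $H$ is the group, unique up to isomorphism, such that: (A) $H$ is countable; (B) $H$ is locally finite (every finitely generated subgroup is finite); (C) every finite group embeds into $H$; (D) any two isomorphic finite subgroups of $H$ are conjugate in $H$. $Aut(\cdot)$ denotes the group of all automorphisms of a group. *)

(* Defs.v *)
From HB Require Import structures.
From mathcomp Require Import all_boot all_fingroup.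
From mathcomp Require Import boolp classical_sets functions cardinality.

Set Implicit Arguments.
Unset Strict Implicit.
Unset Printing Implicit Defensive.

Local Open Scope classical_set_scope.
Local Open Scope group_scope.

(* Groups are [groupType]s and subgroups are [groupClosed] predicates.        *)
(* Choice types and boolean predicates are no restriction, by the classical   *)
(* axioms of boolp.                                                           *)

Definition subgroup (G : groupType) (A : groupClosed G) : Type :=
  {x : G | x \in A}.

Section SubgroupGroup.
Variables (G : groupType) (A : groupClosed G).

HB.instance Definition _ := SubChoice.on (subgroup A).

Let subgroup_closed : group_closed A.
Proof. by split; [exact: gpred1 | exact: gpredF]. Qed.

HB.instance Definition _ :=
  SubChoice_isSubGroup.Build G (fun x => x \in A) (subgroup A) subgroup_closed.

End SubgroupGroup.

(* A multiplicative map between groups preserves 1 and inverses.              *)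
Definition isomorphic (G K : groupType) : Prop :=
  exists f : {multiplicative G -> K}, bijective f.

Definition embeds (G K : groupType) : Prop :=
  exists f : {multiplicative G -> K}, injective f.

Definition generated (G : groupType) (A : set G) : set G :=
  \bigcap_(K in [set K : groupClosed G | A `<=` [set` K]]) [set` K].

Definition locally_finite (G : groupType) : Prop :=
  forall A : set G, finite_set A -> finite_set (generated A).

Section Automorphisms.
Variable G : groupType.

Record gaut : Type := GAut {
  gaut_fun :> G -> G;
  _ : `[< {morph gaut_fun : x y / x * y} /\ bijective gaut_fun >] }.

HB.instance Definition _ := [isSub for gaut_fun].
HB.instance Definition _ := [Choice of gaut by <:].

Lemma gautM (f : gaut) : {morph f : x y / x * y}.
Proof. by case: f => f /= /asboolP[]. Qed.

Lemma gaut_bij (f : gaut) : bijective f.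
Proof. by case: f => f /= /asboolP[]. Qed.

Lemma gautP (f g : gaut) : f =1 g -> f = g.
Proof. by move=> fg; apply: val_inj; apply: funext. Qed.

Let gaut1_subproof :
  `[< {morph (@id G) : x y / x * y} /\ bijective (@id G) >].
Proof. by apply/asboolP; split=> //; exists id. Qed.

Definition gaut1 : gaut := GAut gaut1_subproof.

Let gaut_mul_subproof (f g : gaut) :
  `[< {morph (f \o g) : x y / x * y} /\ bijective (f \o g) >].
Proof.
apply/asboolP; split; first by move=> x y /=; rewrite !gautM.
by apply: bij_comp; exact: gaut_bij.
Qed.

Definition gaut_mul (f g : gaut) : gaut := GAut (gaut_mul_subproof f g).

Let gaut_inv_exists (f : gaut) : exists g : gaut, cancel f g /\ cancel g f.
Proof.
have [g fK gK] := gaut_bij f.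
have gP : `[< {morph g : x y / x * y} /\ bijective g >].
  apply/asboolP; split; last by exists f.
  by move=> x y; apply: (canLR fK); rewrite gautM !gK.
by exists (GAut gP).
Qed.

Definition gaut_inv (f : gaut) : gaut := projT1 (cid (gaut_inv_exists f)).

Lemma gautK (f : gaut) : cancel f (gaut_inv f).
Proof. by rewrite /gaut_inv; case: cid => g /= []. Qed.

Lemma gautVK (f : gaut) : cancel (gaut_inv f) f.
Proof. by rewrite /gaut_inv; case: cid => g /= []. Qed.

Let gaut_mulA : associative gaut_mul. Proof. by move=> f g h; exact: gautP. Qed.
Let gaut_mul1 : left_id gaut1 gaut_mul. Proof. by move=> f; exact: gautP. Qed.
Let gaut_mulr1 : right_id gaut1 gaut_mul. Proof. by move=> f; exact: gautP. Qed.
Let gaut_mulV : left_inverse gaut1 gaut_inv gaut_mul.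
Proof. by move=> f; apply: gautP => x; exact: gautK. Qed.
Let gaut_mulrV : right_inverse gaut1 gaut_inv gaut_mul.
Proof. by move=> f; apply: gautP => x; exact: gautVK. Qed.

HB.instance Definition _ :=
  isGroup.Build gaut gaut_mulA gaut_mul1 gaut_mulr1 gaut_mulV gaut_mulrV.

End Automorphisms.

Record is_hall_universal (H : groupType) : Prop := IsHallUniversal {
  hall_countable : countable [set: H];
  hall_locally_finite : locally_finite H;
  hall_embeds : forall K : finGroupType, embeds K H;
  hall_conjugate : forall A B : groupClosed H,
    finite_set [set` A] -> finite_set [set` B] ->
    isomorphic (subgroup A) (subgroup B) ->
    exists h : H, [set` B] = [set x ^ h | x in [set` A]] }.

(* Main.v *)
From HB Require Import structures.
Require Import Defs.
From mathcomp Require Import all_boot all_fingroup.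
From mathcomp Require Import boolp classical_sets functions cardinality.

Set Implicit Arguments.
Unset Strict Implicit.
Unset Printing Implicit Defensive.

Local Open Scope classical_set_scope.
Local Open Scope group_scope.

(** Call a group homogeneous if every isomorphism between two of its finite
    subgroups is induced by an inner automorphism. Hall's group is homogeneous
    ([hall_homogeneous]), and a back-and-forth argument shows that it is the
    only countable locally finite homogeneous group in which all finite groups
    embed ([back_and_forth]). So it is enough to embed G in some group T with
    these properties on which Aut(G) acts compatibly with its action on G, and
    to compose with an isomorphism from T to H. The extension map is injective
    since every automorphism of G can be read off from its extension.

    T is the union of a chain that starts with G x H, where the factor H is
    there to contain all finite groups. Each step ([conjugating_extension])
    embeds a group G in a countable locally finite group K where any two
    isomorphic finite subgroups of G become conjugate, by an element that
    induces the given isomorphism. Given embeddings u and v of a finite group in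
    G with images in a finite subgroup F, some permutation of G conjugates left
    translation by u a to left translation by v a and preserves all cosets F x
    ([coset_equivariant_bijection]). Adding such permutations to the
    translations of G keeps the group locally finite, because finitely many of
    them lie in a Cartesian power of a finite symmetric group
    ([bounded_generate_finite]).

    The difficulty is to do this with countably many permutations and yet
    without choices, since a choice would not be respected by Aut(G), which may
    be uncountable. There are countably many conjugation problems. Let C be the
    set of all ways to choose a solution for each of them; Aut(G) acts on C. The
    group K consists of permutations of C x G: an element of G acts by
    translation on each copy of G, and each problem p has one generator, which
    acts on the copy of index c by the solution that c chooses for p. So K is
    countably generated, it contains a copy of G, and Aut(G) acts on it because
    its action on C x G permutes the generators. *)

(** * Subgroups and finite subgroups *)

Definition morphism_of (G K : groupType) (f : G -> K)
    (fM : {morph f : x y / x * y}) : {multiplicative G -> K} :=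
  HB.pack_for {multiplicative G -> K} f (isMultiplicative.Build G K f fM).

Section Multiplicative.
Variables (G K : groupType) (f : {multiplicative G -> K}).

Lemma mulf1 : f 1 = 1.
Proof. by apply: (mulgI (f 1)); rewrite -gmulfM !mulg1. Qed.

Lemma mulfV x : f x^-1 = (f x)^-1.
Proof. by apply: (mulgI (f x)); rewrite -gmulfM !mulgV mulf1. Qed.

Lemma mulfJ x y : f (x ^ y) = f x ^ f y.
Proof. by rewrite !conjgE !gmulfM mulfV. Qed.

End Multiplicative.

Lemma groupClosedP (G : groupType) (P : set G) :
  P 1 -> (forall x y, P x -> P y -> P (x * y)) -> (forall x, P x -> P x^-1) ->
  exists A : groupClosed G, [set` A] = P.
Proof.
move=> P1 PM PV.
pose S : {pred G} := fun x => `[< P x >].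
have SP x : reflect (P x) (x \in S) by exact: asboolP.
have s1 : 1 \in S by apply/SP.
have sM : mulg_closed S by move=> x y /SP xP /SP yP; apply/SP/PM.
have sV : invg_closed S by move=> x /SP xP; apply/SP/PV.
pose A : groupClosed G := HB.pack_for (groupClosed G) S
  (isMulClosed.Build _ _ sM) (isMul1Closed.Build _ _ s1)
  (isInvClosed.Build _ _ sV).
by exists A; apply/seteqP; split => x /=; [move/SP | move=> ?; apply/SP].
Qed.

Lemma range_closed (G K : groupType) (f : {multiplicative G -> K}) :
  exists A : groupClosed K, [set` A] = range f.
Proof.
apply: groupClosedP.
- by exists 1; rewrite ?mulf1.
- by move=> _ _ [x _ <-] [y _ <-]; exists (x * y); rewrite ?gmulfM.
- by move=> _ [x _ <-]; exists x^-1; rewrite ?mulfV.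
Qed.

Lemma generated_min (G : groupType) (A : groupClosed G) (S : set G) :
  S `<=` [set` A] -> Defs.generated S `<=` [set` A].
Proof. by move=> SA x; apply. Qed.

Lemma generated_closed (G : groupType) (S : set G) :
  exists A : groupClosed G, [set` A] = Defs.generated S.
Proof.
apply: groupClosedP.
- by move=> A _; exact: gpred1.
- by move=> x y xS yS A SA; apply: gpredM; [exact: xS | exact: yS].
- by move=> x xS A SA; apply: gpredVr; exact: xS.
Qed.

Lemma finite_subgroup (G : groupType) (A : groupClosed G) :
  finite_set [set` A] ->
  exists (F : finGroupType) (e : {multiplicative F -> G}),
    injective e /\ range e = [set` A].
Proof.
move=> /finite_seqP[s As].
have sP x : (x \in s) = (x \in A).
  have /= /propeqP[h1 h2] := congr1 (fun B : set G => B x) As.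
  by apply/idP/idP.
pose inF x (xA : x \in A) : seq_sub s := SeqSub (etrans (sP x) xA).
have FA (x : seq_sub s) : val x \in A by rewrite -sP; exact: valP.
pose mul x y := inF _ (gpredM _ _ (FA x) (FA y)).
pose one := inF _ (gpred1 : 1 \in A).
pose inv x := inF _ (gpredVr _ (FA x)).
have mulA : associative mul by move=> x y z; apply/val_inj/mulgA.
have mul1 : left_id one mul by move=> x; apply/val_inj/mul1g.
have mulV : left_inverse one inv mul by move=> x; apply/val_inj/mulVg.
pose F : finGroupType := HB.pack_for finGroupType (seq_sub s)
  (Finite_isGroup.Build (seq_sub s) mulA mul1 mulV).
pose e : F -> G := val.
have eM : {morph e : x y / x * y} by [].
exists F, (morphism_of eM); split; first exact: val_inj.
apply/seteqP; split => [_ [x _ <-]|x xA]; first exact: FA.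
by exists (inF x xA).
Qed.

(** Finite subgroups are handled below as injective images of abstract finite
    groups: unlike subgroups, these can be compared and extended without
    reference to the ambient group. *)
Lemma locally_finiteP (G : groupType) : locally_finite G <->
  forall s : seq G, exists (F : finGroupType) (e : {multiplicative F -> G}),
    injective e /\ {in s, forall x, exists a, e a = x}.
Proof.
split=> [lfG s|cov A /finite_seqP[s ->]].
  have [A AE] := generated_closed [set` s].
  have /finite_subgroup[F [e [einj eA]]] : finite_set [set` A].
    by rewrite AE; apply: lfG; exact: finite_seq.
  exists F, e; split=> // x xs.
  have [a _ <-] : range e x by rewrite eA AE => B; apply.
  by exists a.
have [F [e [_ es]]] := cov s.
have [B BE] := range_closed e.
apply: (@sub_finite_set _ _ [set` B]); last first.
  by rewrite BE; exact/finite_image/finite_finset.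
by apply: generated_min; rewrite BE => x /es[a <-]; exists a.
Qed.

(** * Homogeneity *)

(** Stronger than conjugacy of isomorphic finite subgroups: the conjugation has
    to induce the prescribed isomorphism from the image of u to that of v. *)
Definition homogeneous (X : groupType) : Prop :=
  forall (A : finGroupType) (u v : {multiplicative A -> X}),
    injective u -> injective v -> exists t : X, forall a, u a ^ t = v a.

Lemma factor_through (A B X : groupType)
    (u : {multiplicative A -> X}) (e : {multiplicative B -> X}) :
  injective e -> (forall a, exists b, e b = u a) ->
  exists i : {multiplicative A -> B}, forall a, e (i a) = u a.
Proof.
move=> einj /choice[i eiu].
have iM : {morph i : x y / x * y}.
  by move=> x y; apply: einj; rewrite gmulfM !eiu gmulfM.
by exists (morphism_of iM).
Qed.

Lemma factor_inj (A B X : Type) (u : A -> X) (e : B -> X) (i : A -> B) :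
  injective u -> (forall a, e (i a) = u a) -> injective i.
Proof. by move=> uinj eiu x y ixy; apply: uinj; rewrite -!eiu ixy. Qed.

(** In the symmetric group on A an automorphism of A is itself an element, and
    it conjugates right translation by a to right translation by its image. *)
Lemma regular_representation (A : finGroupType) :
  exists w : {multiplicative A -> {perm A}}, injective w /\
    forall s : {perm A}, {morph s : x y / x * y} -> forall a, w a ^ s = w (s a).
Proof.
pose w (a : A) : {perm A} := perm (mulIg a).
have wM : {morph w : a b / a * b}.
  by move=> a b; apply/permP => x; rewrite permM !permE mulgA.
exists (morphism_of wM); split=> [a b /permP/(_ 1)|s sM a].
  by rewrite !permE !mul1g.
apply/permP => x; rewrite conjgE !permM [morphism_of wM a _]permE.
by rewrite sM -permM mulVg perm1 permE.
Qed.

Lemma corestriction (X G : groupType) (f : {multiplicative X -> G})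
    (A : groupClosed G) :
  injective f -> [set` A] = range f ->
  exists h : {multiplicative X -> subgroup A},
    bijective h /\ forall x, val (h x) = f x.
Proof.
move=> finj Af.
have fA x : f x \in A by have /= -> : [set` A] (f x) by rewrite Af; exists x.
pose h x : subgroup A := Sub (f x) (fA x).
have hM : {morph h : x y / x * y} by move=> x y; apply/val_inj/gmulfM.
have /choice[k fk] (y : subgroup A) : exists x, f x = val y.
  have [x _ fx] : range f (val y) by rewrite -Af; exact: valP.
  by exists x.
exists (morphism_of hM); split=> //; exists k => [x|y]; first exact/finj/fk.
exact/val_inj/fk.
Qed.

Lemma isomorphic_ranges (X G K : groupType) (f : {multiplicative X -> G})
    (g : {multiplicative X -> K}) (A : groupClosed G) (B : groupClosed K) :
  injective f -> injective g -> [set` A] = range f -> [set` B] = range g ->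
  isomorphic (subgroup A) (subgroup B).
Proof.
move=> finj ginj Af Bg.
have [h [[h' hK h'K] _]] := corestriction finj Af.
have [k [kbij _]] := corestriction ginj Bg.
exists (k \o morphism_of (can2_gmulfM hK h'K)).
by apply: bij_comp => //; exists h.
Qed.

Definition conjugation (G : groupType) (g : G) : {multiplicative G -> G} :=
  morphism_of (fun x y => conjMg x y g).

(** Conjugacy of isomorphic finite subgroups controls an isomorphism only up to
    an automorphism of A. One copy m of A in H has all its automorphisms induced
    by H, namely the copy inside a symmetric group on A embedded in H; so every
    embedding e of A is conjugate to m, after correcting by an automorphism. *)
Lemma hall_homogeneous (H : groupType) : is_hall_universal H -> homogeneous H.
Proof.
move=> hallH A u v uinj vinj.
have [w [winj wJ]] := regular_representation A.
have [z zinj] := hall_embeds hallH {perm A}.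
pose m : {multiplicative A -> H} := z \o w.
have minj : injective m by move=> a b /zinj/winj.
suff key (e : {multiplicative A -> H}) : injective e ->
    exists g, forall a, m a ^ g = e a.
  have [g mg] := key u uinj; have [h mh] := key v vinj.
  by exists (g^-1 * h) => a; rewrite -mg conjgM conjgK.
move=> einj.
have [M ME] := range_closed m; have [E EE] := range_closed e.
have finr (f : A -> H) : finite_set (range f).
  exact/finite_image/finite_finset.
have [|||g EMg] := hall_conjugate hallH (A := M) (B := E).
- by rewrite ME; exact: finr.
- by rewrite EE; exact: finr.
- exact: isomorphic_ranges ME EE.
(* b is the discrepancy between e and the conjugate of m onto the range of e. *)
have [b eb] : exists b : {multiplicative A -> A},
    forall a, e (b a) = (conjugation g \o m) a.
  apply: factor_through => // a.
  have [c _ ec] : range e (m a ^ g).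
    by rewrite -EE EMg; exists (m a) => //; rewrite ME; exists a.
  by exists c.
have binj : injective b.
  by apply: factor_inj eb; apply: inj_comp minj; exact: conjg_inj.
pose s := (perm binj)^-1.
have sK a : b (s a) = a by rewrite -[RHS](permKV (perm binj)) permE.
have sM : {morph s : x y / x * y}.
  by move=> x y; apply: (binj); rewrite gmulfM !sK.
exists (z s * g) => a.
have mJ : m a ^ z s = m (s a) by rewrite /= -mulfJ wJ.
by rewrite conjgM mJ -[LHS]eb sK.
Qed.

(** * Back and forth *)

(** Embed B anywhere, then conjugate the copy of A inside it onto the given
    one. *)
Lemma homogeneous_extension (X : groupType) (A B : finGroupType)
    (i : {multiplicative A -> B}) (u : {multiplicative A -> X}) :
  homogeneous X -> embeds B X -> injective i -> injective u ->
  exists v : {multiplicative B -> X}, injective v /\ forall a, v (i a) = u a.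
Proof.
move=> homX [z zinj] iinj uinj.
have [t zt] := homX A (z \o i) u (inj_comp zinj iinj) uinj.
exists (conjugation t \o z); split=> //.
by apply: inj_comp zinj; exact: conjg_inj.
Qed.

Lemma countable_enum (T : choiceType) (x0 : T) (S : set T) : countable S ->
  exists e : nat -> T, forall x, S x -> exists n, e n = x.
Proof.
move=> /countable_injP[f finj].
have /choice[e eP] (n : nat) :
    exists x, (exists2 y, S y & f y = n) -> S x /\ f x = n.
  have [[y Sy fy]|nofy] := pselect (exists2 y, S y & f y = n).
    by exists y.
  by exists x0.
exists e => x Sx; exists (f x).
have [|Se fe] := eP (f x); first by exists x.
by apply: finj; rewrite ?inE.
Qed.

(** The list s need not be closed under products: it is only a part of the
    graph of an isomorphism between finite subgroups. Adding one pair is then a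
    single cons, although the subgroups behind it may grow a lot. *)
Definition partial_iso (X Y : groupType) (s : seq (X * Y)) : Prop :=
  exists (A : finGroupType) (u : {multiplicative A -> X})
         (v : {multiplicative A -> Y}),
    [/\ injective u, injective v &
        {in s, forall p, exists a, (u a, v a) = p}].

(** Local finiteness of X puts x and the old domain in one finite subgroup B,
    and homogeneity of Y extends the embedding of the old domain to B. *)
Lemma partial_iso_extend (X Y : groupType) (s : seq (X * Y)) (x : X) :
  locally_finite X -> homogeneous Y -> (forall K : finGroupType, embeds K Y) ->
  partial_iso s -> exists y, partial_iso ((x, y) :: s).
Proof.
move=> /locally_finiteP lfX homY embY [A [u [v [uinj vinj uvs]]]].
have [B [e [einj eP]]] := lfX (x :: [seq u a | a <- enum A]).
have [i eiu] : exists i : {multiplicative A -> B}, forall a, e (i a) = u a.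
  apply: factor_through => // a; apply: eP.
  by rewrite inE map_f ?orbT // mem_enum.
have iinj := factor_inj uinj eiu.
have [w [winj wi]] := homogeneous_extension homY (embY B) iinj vinj.
have [b ebx] := eP x (mem_head _ _).
exists (w b), B, e, w; split=> // p; rewrite inE => /orP[/eqP ->|/uvs[a <-]].
  by exists b; rewrite ebx.
by exists (i a); rewrite eiu wi.
Qed.

Lemma partial_iso_swap (X Y : groupType) (s : seq (X * Y)) :
  partial_iso s -> partial_iso [seq (p.2, p.1) | p <- s].
Proof.
move=> [A [u [v [uinj vinj uvs]]]]; exists A, v, u; split=> // q.
by move=> /mapP[p /uvs[a <-] ->]; exists a.
Qed.

Lemma partial_iso_sub (X Y : groupType) (s t : seq (X * Y)) :
  {subset s <= t} -> partial_iso t -> partial_iso s.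
Proof.
move=> st [A [u [v [uinj vinj uvt]]]]; exists A, u, v; split=> // p /st.
exact: uvt.
Qed.

(** Alternately adding the n-th element of X to the domain and the n-th element
    of Y to the range gives an increasing chain of finite partial isomorphisms;
    its union R is the graph of an isomorphism, because every statement about
    finitely many pairs of R can be checked inside one member of the chain. *)
Lemma back_and_forth (X Y : groupType) :
  countable [set: X] -> locally_finite X -> homogeneous X ->
  (forall K : finGroupType, embeds K X) ->
  countable [set: Y] -> locally_finite Y -> homogeneous Y ->
  (forall K : finGroupType, embeds K Y) ->
  isomorphic X Y.
Proof.
move=> cX lX hX eX cY lY hY eY.
have [ex exP] := countable_enum 1 cX; have [ey eyP] := countable_enum 1 cY.
pose good := {s : seq (X * Y) | partial_iso s}.
have good0 : partial_iso ([::] : seq (X * Y)).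
  have [z zinj] := eX {perm void}; have [z' zinj'] := eY {perm void}.
  by exists {perm void}, z, z'.
have /choice[nxt nxtP] (c : nat * good) : exists d : good,
    [/\ {subset sval c.2 <= sval d},
        exists y, (ex c.1, y) \in sval d & exists x, (x, ey c.1) \in sval d].
  case: c => n [s sP] /=.
  have [y yP] := partial_iso_extend (ex n) lX hY eY sP.
  have [x xP] := partial_iso_extend (ey n) lY hX eX (partial_iso_swap yP).
  have /= := partial_iso_swap xP.
  rewrite -map_comp map_id_in => [zP|[] //].
  exists (exist _ _ zP) => /=; split.
  - by move=> p ps; rewrite !inE ps !orbT.
  - by exists y; rewrite !inE eqxx orbT.
  - by exists x; rewrite !inE eqxx.
pose chain := fix chain n : good :=
  if n is m.+1 then nxt (m, chain m) else exist _ _ good0.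
pose R x y := exists n, (x, y) \in sval (chain n).
have chain_mono m n : m <= n -> {subset sval (chain m) <= sval (chain n)}.
  elim: n => [|n IHn]; first by rewrite leqn0 => /eqP ->.
  rewrite leq_eqVlt => /orP[/eqP -> //|/IHn mn] p /mn.
  by have [+ _ _] := nxtP (n, chain n); apply.
have R3 x y x' y' x'' y'' : R x y -> R x' y' -> R x'' y'' ->
    partial_iso [:: (x, y); (x', y'); (x'', y'')].
  move=> [n1 p1] [n2 p2] [n3 p3].
  apply: (@partial_iso_sub _ _ _ (sval (chain (maxn n1 (maxn n2 n3))))).
    move=> p; rewrite !inE => /or3P[] /eqP ->.
    - by apply: chain_mono p1; rewrite leq_maxl.
    - by apply: chain_mono p2; rewrite !leq_max leqnn orbT.
    - by apply: chain_mono p3; rewrite !leq_max leqnn !orbT.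
  exact: proj2_sig.
have R_total x : exists y, R x y.
  have [n <-] := exP x I; have [_ [y Hy] _] := nxtP (n, chain n).
  by exists y, n.+1.
have R_onto y : exists x, R x y.
  have [n <-] := eyP y I; have [_ _ [x Hx]] := nxtP (n, chain n).
  by exists x, n.+1.
have RP x y x' y' : R x y -> R x' y' -> (x = x' <-> y = y').
  move=> r r'; have [A [u [v [uinj vinj uv]]]] := R3 _ _ _ _ _ _ r r r'.
  have [|a [<- <-]] := uv (x, y); first by rewrite inE eqxx.
  have [|b [<- <-]] := uv (x', y'); first by rewrite !inE eqxx !orbT.
  by split=> [/uinj|/vinj] ->.
have RM x y x' y' : R x y -> R x' y' -> R (x * x') (y * y').
  move=> r r'; have [z rz] := R_total (x * x'); move: (rz).
  have [A [u [v [uinj vinj uv]]]] := R3 _ _ _ _ _ _ r r' rz.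
  have [|a [ua va]] := uv (x, y); first by rewrite inE eqxx.
  have [|b [ub vb]] := uv (x', y'); first by rewrite !inE eqxx !orbT.
  have [|c [uc vc]] := uv (x * x', z); first by rewrite !inE eqxx !orbT.
  by rewrite -vc -va -vb -gmulfM (uinj (a * b) c) // gmulfM ua ub uc.
have [f fP] := choice R_total; have [g gP] := choice R_onto.
have fM : {morph f : x y / x * y}.
  by move=> x y; apply/(RP _ _ _ _ (fP _) (RM _ _ _ _ (fP x) (fP y))).
exists (morphism_of fM); exists g => [x|y].
  exact/(RP _ _ _ _ (gP _) (fP _)).
exact/(RP _ _ _ _ (fP _) (gP _)).
Qed.

(** * Equivariant bijections *)

(** Right cosets of the image of e are the orbits of B acting by left
    multiplication; r picks a point in each orbit and q x is the coordinate of x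
    relative to that point. *)
Lemma coset_representatives (B X : groupType) (e : {multiplicative B -> X}) :
  exists (r : X -> X) (q : X -> B),
    (forall x, e (q x) * r x = x) /\ (forall b x, r (e b * x) = r x).
Proof.
pose orb x : set X := [set y | exists b, y = e b * x].
pose r x := xget 1 (orb x).
have rP x : orb x (r x).
  by apply: (@xgetPex _ 1 (orb x)); exists x, 1; rewrite mulf1 mul1g.
have /choice[q qP] x : exists b, e b * r x = x.
  have [b ->] := rP x; exists b^-1.
  by rewrite mulfV mulKg.
exists r, q; split=> // b x; congr (xget 1 _).
apply/seteqP; split => [_ [c ->]|_ [c ->]].
  by exists (c * b); rewrite gmulfM mulgA.
by exists (c * b^-1); rewrite gmulfM mulfV mulgA mulgVK.
Qed.

(** A acts freely on F through u and through v, so both actions have the same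
    number of orbits; match the orbit representatives arbitrarily and extend
    equivariantly. *)
Lemma finite_equivariant_bijection (A F : finGroupType)
    (u v : {multiplicative A -> F}) :
  injective u -> injective v ->
  exists s : F -> F, bijective s /\ forall a x, s (u a * x) = v a * s x.
Proof.
move=> uinj vinj.
(* The number of orbits of a free action is the quotient of the orders. *)
have orbits (w : {multiplicative A -> F}) (winj : injective w) :
    exists (r : F -> F) (q : F -> A) (S : {set F}),
      [/\ (forall x, w (q x) * r x = x) /\ (forall a x, r (w a * x) = r x),
          forall x, (x \in S) = (r x == x), forall x, r x \in S &
          (#|A| * #|S| = #|F|)%N].
  have [r [q [qr rw]]] := coset_representatives w.
  have rr x : r (r x) = r x by rewrite -{2}(qr x) rw.
  exists r, q, (finset (fun x => r x == x)); split=> // [x|x|].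
  - by rewrite inE.
  - by rewrite inE rr.
  rewrite -cardsT -cardsX -cardsT.
  pose h (p : A * F) := w p.1 * p.2.
  rewrite -(@card_in_imset _ _ h); last first.
    move=> [a x] [b y]; rewrite !inE /h /= => /eqP rx /eqP ry E.
    have xy : x = y by rewrite -rx -ry -(rw a) -(rw b y) E.
    by move: E; rewrite xy => /mulIg/winj ->.
  apply: eq_card => x; rewrite inE; apply/imsetP.
  by exists (q x, r x); rewrite ?inE /h /= ?rr ?qr.
have [r1 [q1 [S1 [[qr1 ru1] S1P r1S cS1]]]] := orbits u uinj.
have [r2 [q2 [S2 [[qr2 rv2] S2P r2S cS2]]]] := orbits v vinj.
have cS : #|S1| = #|S2|.
  apply/eqP; rewrite -(@eqn_pmul2l #|A|); first by rewrite cS1 cS2.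
  by apply/card_gt0P; exists 1.
pose h x := nth 1 (enum S2) (index x (enum S1)).
have idx x : x \in S1 -> index x (enum S1) < size (enum S2).
  by move=> xS; rewrite -cardE -cS cardE index_mem mem_enum.
have hS x : x \in S1 -> h x \in S2.
  by move=> xS; rewrite -mem_enum mem_nth // idx.
have hinj : {in S1 &, injective h}.
  move=> x y xS yS /eqP; rewrite nth_uniq ?enum_uniq ?idx // => /eqP E.
  rewrite -(nth_index 1 (s := enum S1) (x := x)) ?mem_enum // E.
  by rewrite nth_index ?mem_enum.
have q1u a x : q1 (u a * x) = a * q1 x.
  apply: uinj; apply: (mulIg (r1 x)).
  by rewrite -{1}(ru1 a x) qr1 gmulfM -mulgA qr1.
pose s x := v (q1 x) * h (r1 x).
have r2s x : r2 (s x) = h (r1 x).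
  by rewrite rv2; apply/eqP; rewrite -S2P hS.
exists s; split=> [|a x]; last by rewrite /s ru1 q1u gmulfM mulgA.
apply: injF_bij => x y sxy.
have rxy : r1 x = r1 y by apply: hinj => //; rewrite -!r2s sxy.
move: sxy; rewrite /s rxy => /mulIg/vinj qxy.
by rewrite -(qr1 x) -(qr1 y) qxy rxy.
Qed.

(** Copy the bijection given by the finite case to every right coset of F.
    Seen in the group of all permutations of G, s conjugates left translation by
    u a to left translation by v a; and as it moves points only inside the cosets
    of F, adding it to the translations keeps the group locally finite. *)
Lemma coset_equivariant_bijection (G : groupType) (A F : finGroupType)
    (e : {multiplicative F -> G}) (u v : {multiplicative A -> G}) :
  injective e -> injective u -> injective v ->
  (forall a, exists b, e b = u a) -> (forall a, exists b, e b = v a) ->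
  exists s : G -> G,
    [/\ bijective s, forall x, exists b, s x = e b * x &
        forall a x, s (u a * x) = v a * s x].
Proof.
move=> einj uinj vinj ue ve.
have [u' eu'] := factor_through einj ue.
have [v' ev'] := factor_through einj ve.
have [t [[t' tK t'K] tE]] :=
  finite_equivariant_bijection (factor_inj uinj eu') (factor_inj vinj ev').
have [r [q [qr re]]] := coset_representatives e.
have qe b x : q (e b * x) = b * q x.
  apply: einj; apply: (mulIg (r x)).
  by rewrite -{1}(re b x) qr gmulfM -mulgA qr.
have r_r x : r (r x) = r x by rewrite -{2}(qr x) re.
have q_r x : q (r x) = 1.
  apply: einj; apply: (mulIg (r x)).
  by rewrite -{2}(r_r x) qr mulf1 mul1g.
pose lift (k : F -> F) x := e (k (q x)) * r x.
have liftK k k' : cancel k k' -> cancel (lift k) (lift k').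
  by move=> kK x; rewrite /lift re r_r qe q_r mulg1 kK qr.
exists (lift t); split=> [|x|a x].
- by exists (lift t'); apply: liftK.
- exists (t (q x) * (q x)^-1).
  rewrite gmulfM mulfV -mulgA; congr (_ * _).
  exact: canRL (mulKg _) (qr x).
- by rewrite /lift -eu' re qe tE gmulfM ev' mulgA.
Qed.

(** * Groups of permutations *)

Section Permutations.
Variable T : Type.

Record sym : Type := Sym { sym_fun :> T -> T; _ : `[< bijective sym_fun >] }.

HB.instance Definition _ := [isSub for sym_fun].
HB.instance Definition _ := gen_eqMixin sym.
HB.instance Definition _ := gen_choiceMixin sym.

Lemma symP (s t : sym) : s =1 t -> s = t.
Proof. by move=> st; apply: val_inj; apply: funext. Qed.

Definition mksym (f g : T -> T) (fK : cancel f g) (gK : cancel g f) : sym :=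
  Sym (introT (asboolP _) (Bijective fK gK)).

Lemma sym_inv_exists (s : sym) : exists t : sym, cancel s t /\ cancel t s.
Proof.
case: s => f fb; have [g fK gK] := elimT (asboolP _) fb.
by exists (mksym gK fK).
Qed.

Definition sym_one : sym := @mksym id id (fun x => erefl x) (fun x => erefl x).
Definition sym_inv (s : sym) : sym := projT1 (cid (sym_inv_exists s)).

Lemma sym_invK (s : sym) : cancel s (sym_inv s).
Proof. by rewrite /sym_inv; case: cid => t /= []. Qed.

Lemma sym_invVK (s : sym) : cancel (sym_inv s) s.
Proof. by rewrite /sym_inv; case: cid => t /= []. Qed.

Definition sym_mul (s t : sym) : sym :=
  mksym (can_comp (sym_invK s) (sym_invK t))
        (can_comp (sym_invVK t) (sym_invVK s)).

Let sym_mulA : associative sym_mul. Proof. by move=> s t r; exact: symP. Qed.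
Let sym_mul1 : left_id sym_one sym_mul. Proof. by move=> s; exact: symP. Qed.
Let sym_mulr1 : right_id sym_one sym_mul. Proof. by move=> s; exact: symP. Qed.
Let sym_mulV : left_inverse sym_one sym_inv sym_mul.
Proof. by move=> s; apply: symP => x; exact: sym_invK. Qed.
Let sym_mulrV : right_inverse sym_one sym_inv sym_mul.
Proof. by move=> s; apply: symP => x; exact: sym_invVK. Qed.

HB.instance Definition _ :=
  isGroup.Build sym sym_mulA sym_mul1 sym_mulr1 sym_mulV sym_mulrV.

Lemma symM (s t : sym) x : (s * t) x = s (t x). Proof. by []. Qed.

Lemma sym1 x : (1 : sym) x = x. Proof. by []. Qed.

Lemma symK (s : sym) x : s^-1 (s x) = x. Proof. exact: sym_invK. Qed.

Lemma symVK (s : sym) x : s (s^-1 x) = x. Proof. exact: sym_invVK. Qed.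

End Permutations.

Section BoundedPermutations.
Variables (F : finGroupType) (Y : Type) (act : F -> Y -> Y).
Hypothesis act1 : forall y, act 1 y = y.
Hypothesis actM : forall a b y, act (a * b) y = act a (act b y).

(** This is the local finiteness of a Cartesian power of a finite group, for
    permutations that preserve the orbits of F. Record for each point y how the
    finitely many permutations in B move the points of its orbit; there are
    finitely many such patterns, and the permutations that move all points with
    the same pattern by the same element of F form a finite group containing B.
    A pattern is a relation, because the element of F that moves a point as
    prescribed need not be unique. *)
Lemma bounded_generate_finite (B : set (sym Y)) :
  finite_set B -> (forall s, B s -> forall y, exists a, s y = act a y) ->
  exists A : groupClosed (sym Y), B `<=` [set` A] /\ finite_set [set` A].
Proof.
move=> /finite_seqP[bs ->] Bact.
pose n := size bs.
pose pattern := {ffun 'I_n * F * F -> bool}.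
pose pat y : pattern := [ffun p : 'I_n * F * F =>
  `[< (nth 1 bs p.1.1) (act p.1.2 y) = act p.2 (act p.1.2 y) >]].
pose shift (b : F) (pi : pattern) : pattern :=
  [ffun p : 'I_n * F * F => pi (p.1.1, p.1.2 * b, p.2)].
(* The pattern of a point determines the patterns of its whole orbit. *)
have pat_act b y : pat (act b y) = shift b (pat y).
  by apply/ffunP => p; rewrite !ffunE /= actM.
pose U : set (sym Y) :=
  [set s | forall pi, exists a, forall y, pat y = pi -> s y = act a y].
have [|||A AU] := @groupClosedP (sym Y) U.
- by move=> pi; exists 1 => y _; rewrite act1.
- move=> s t sU tU pi; have [b tb] := tU pi; have [a sa] := sU (shift b pi).
  by exists (a * b) => y piy; rewrite symM tb // actM sa // pat_act piy.
- move=> s sU pi.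
  have [[z zpi]|nopi] := pselect (exists z, pat z = pi); last first.
    by exists 1 => y ypi; case: nopi; exists y.
  have [a sa] := sU (pat (s^-1 z)).
  have za : z = act a (s^-1 z) by rewrite -sa // symVK.
  exists a^-1 => y ypi.
  have /sa : pat (act a^-1 y) = pat (s^-1 z).
    by rewrite pat_act ypi -zpi -pat_act {1}za -actM mulVg act1.
  by rewrite -actM mulgV act1 => sy; rewrite -{1}sy symK.
exists A; rewrite AU; split=> [s sbs pi|].
  have [[z zpi]|nopi] := pselect (exists z, pat z = pi); last first.
    by exists 1 => y ypi; case: nopi; exists y.
  have [a sa] := Bact s sbs z.
  have ilt : index s bs < n by rewrite index_mem.
  exists a => y ypi.
  have /ffunP/(_ (Ordinal ilt, 1, a)) : pat y = pat z by rewrite ypi.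
  rewrite !ffunE /= nth_index // !act1 => E.
  by apply/asboolP; rewrite E; apply/asboolP.
(* An element of A is determined by one element of F for each pattern. *)
pose decode (al : {ffun pattern -> F}) : sym Y :=
  xget 1 [set s : sym Y | forall y, s y = act (al (pat y)) y].
apply: (@sub_finite_set _ _ (range decode)); last first.
  exact/finite_image/finite_finset.
move=> s sU; have [al alP] := choice sU.
exists [ffun pi => al pi] => //.
rewrite /decode; case: xgetP => [t _ /= tP|/(_ s)[]].
  by apply: symP => y; rewrite tP ffunE (alP _ y erefl).
by move=> y; rewrite ffunE (alP _ y erefl).
Qed.

End BoundedPermutations.

Lemma countable_range (I : countType) (T : Type) (f : I -> T) :
  countable (range f).
Proof. exact: sub_countable (card_image_le _ _) (countableP _). Qed.

Lemma countable_generated (G : groupType) (S : set G) :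
  countable S -> countable (Defs.generated S).
Proof.
move=> /(countable_enum 1)[e eS].
pose letter (p : bool * nat) := if p.1 then (e p.2)^-1 else e p.2.
pose word (w : seq (bool * nat)) := foldr (fun p x => letter p * x) 1 w.
have wordM w1 w2 : word (w1 ++ w2) = word w1 * word w2.
  by elim: w1 => [|p w1 IH] /=; rewrite ?mul1g // IH mulgA.
have [|||A AW] := @groupClosedP G (range word).
- by exists [::].
- by move=> _ _ [w1 _ <-] [w2 _ <-]; exists (w1 ++ w2).
- move=> _ [w _ <-]; elim: w => [|[b n] w [w' _ IH]] /=.
    by exists [::]; rewrite ?invg1.
  exists (w' ++ [:: (~~ b, n)]) => //.
  rewrite invgM -IH wordM /= mulg1; congr (_ * _).
  by rewrite /letter; case: b; rewrite /= ?invgK.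
apply: sub_countable (countable_range word).
apply: subset_card_le; rewrite -AW; apply: generated_min.
rewrite AW => x /eS[n <-].
by exists [:: (false, n)] => //=; rewrite mulg1.
Qed.

(** * The group generated by translations and twists *)

Definition gaut_sym (G : groupType) (f : gaut G) : sym G :=
  mksym (gautK f) (gautVK f).

Lemma gaut_symM (G : groupType) : {morph @gaut_sym G : f g / f * g}.
Proof. by move=> f g; apply: symP. Qed.

HB.instance Definition _ (G : groupType) :=
  isMultiplicative.Build (gaut G) (sym G) (@gaut_sym G) (@gaut_symM G).

Lemma conjgVE (G : groupType) (x y : G) : x ^ y^-1 = y * x * y^-1.
Proof. by rewrite conjgE invgK mulgA. Qed.

Section Twists.
Variable G : groupType.

(** A constraint p asks for a permutation of G that conjugates left translation
    by a to left translation by b for each pair (a, b) in p.1, while it moves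
    every x inside the finite set p.2 x. Finite lists are used so that there are
    countably many constraints and Aut(G) acts on them entry by entry. *)
Definition constraint : Type := (seq (G * G) * seq G)%type.

Definition gaut_constraint (f : gaut G) (p : constraint) : constraint :=
  ([seq (f q.1, f q.2) | q <- p.1], map f p.2).

Lemma gaut_constraintM f g p :
  gaut_constraint (f * g) p = gaut_constraint f (gaut_constraint g p).
Proof. by rewrite /gaut_constraint /= -!map_comp. Qed.

Lemma gaut_constraint1 p : gaut_constraint 1 p = p.
Proof.
case: p => p1 p2; rewrite /gaut_constraint /=.
by congr pair; apply: map_id_in => // -[].
Qed.

Definition satisfies (p : constraint) (s : sym G) : Prop :=
  (forall x, s x * x^-1 \in p.2) /\
  {in p.1, forall q, forall x, s (q.1 * x) = q.2 * s x}.

(** The disjunction makes sure that every constraint has an admissible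
    permutation; and admissibility is invariant under Aut(G), since it does not
    depend on any choice. *)
Definition admissible (p : constraint) (s : sym G) : Prop :=
  satisfies p s \/ (s = 1 /\ ~ exists t, satisfies p t).

Definition transport (f : gaut G) (s : sym G) : sym G :=
  s ^ (gaut_sym f)^-1.

Lemma transportE f s x : transport f s (f x) = f (s x).
Proof.
by rewrite /transport (conjgVE s) !symM -[f x]/(gaut_sym f x) symK.
Qed.

Lemma transport_one f : transport f 1 = 1.
Proof. by rewrite /transport conj1g. Qed.

Lemma transport1 s : transport 1 s = s.
Proof. by rewrite /transport (mulf1 (@gaut_sym G)) (@invg1 (sym G)) conjg1. Qed.

Lemma transportM f g s : transport (f * g) s = transport f (transport g s).
Proof.
by rewrite /transport gaut_symM (@invgM (sym G)) conjgM.
Qed.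

Lemma satisfies_gaut f p s :
  satisfies p s -> satisfies (gaut_constraint f p) (transport f s).
Proof.
have fsurj y : exists x, y = f x.
  by exists ((gaut_sym f)^-1 y); rewrite -[RHS]/(gaut_sym f _) symVK.
move=> [sx sq]; split=> [y|_ /mapP[q qp ->] y]; have [x ->] := fsurj y.
  have fV : f x^-1 = (f x)^-1 := mulfV (morphism_of (gautM f)) x.
  by rewrite transportE -fV -gautM; exact: map_f.
by rewrite -gautM !transportE sq // gautM.
Qed.

Lemma admissible_gaut f p s :
  admissible p s -> admissible (gaut_constraint f p) (transport f s).
Proof.
case=> [sp|[-> nop]]; [left; exact: satisfies_gaut | right].
split=> [|[t /(satisfies_gaut f^-1)]]; first by rewrite transport_one.
rewrite -gaut_constraintM mulVg gaut_constraint1 => tp.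
by apply: nop; eexists; exact: tp.
Qed.

(** Choosing one admissible permutation for each constraint would break the
    symmetry under Aut(G), so all systems of choices are used at the same
    time: the permutations below act on pairs of a system and a point of G. *)
Definition assignment : Type :=
  {c : constraint -> sym G | forall p, admissible p (c p)}.

Lemma assignmentP (c d : assignment) : sval c =1 sval d -> c = d.
Proof.
case: c d => [c cP] [d dP] /= /funext cd; case: _ / cd dP => dP.
by congr (exist _ _ _); exact: Prop_irrelevance.
Qed.

Lemma exists_assignment : assignment.
Proof.
have ex p : exists s, admissible p s.
  have [[s sp]|nop] := pselect (exists s, satisfies p s).
    by exists s; left.
  by exists 1; right.
by have [c cP] := choice ex; exists c.
Qed.

Definition gaut_assignment (f : gaut G) (c : assignment) : assignment.
Proof.
exists (fun p => transport f (sval c (gaut_constraint f^-1 p))) => p.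
rewrite -{1}[p]gaut_constraint1 -(mulgV f) gaut_constraintM.
exact/admissible_gaut/(proj2_sig c).
Defined.

Definition gaut_points (f : gaut G) (y : assignment * G) : assignment * G :=
  (gaut_assignment f y.1, f y.2).

Lemma gaut_points1 y : gaut_points 1 y = y.
Proof.
case: y => c x; congr (_, _); apply: assignmentP => p /=.
by rewrite invg1 gaut_constraint1 transport1.
Qed.

Lemma gaut_pointsM f g y :
  gaut_points (f * g) y = gaut_points f (gaut_points g y).
Proof.
case: y => c x; congr (_, _); apply: assignmentP => p /=.
by rewrite invgM gaut_constraintM transportM.
Qed.

Lemma gaut_pointsK f : cancel (gaut_points f) (gaut_points f^-1).
Proof. by move=> y; rewrite -gaut_pointsM mulVg gaut_points1. Qed.

Lemma gaut_pointsVK f : cancel (gaut_points f^-1) (gaut_points f).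
Proof. by move=> y; rewrite -gaut_pointsM mulgV gaut_points1. Qed.

(** Conjugation by push f permutes the translations and the twists, hence
    acts on the group that they generate. *)
Definition push (f : gaut G) : sym (assignment * G) :=
  mksym (gaut_pointsK f) (gaut_pointsVK f).

Lemma pushM : {morph push : f g / f * g}.
Proof. by move=> f g; apply: symP => y; exact: gaut_pointsM. Qed.

Definition fiberwise (h : assignment -> sym G) : sym (assignment * G).
Proof.
apply: (@mksym _ (fun y => (y.1, h y.1 y.2)) (fun y => (y.1, (h y.1)^-1 y.2))).
  by case=> c x /=; rewrite symK.
by case=> c x /=; rewrite symVK.
Defined.

Definition lmul (g : G) : sym G := mksym (mulKg g) (mulVKg g).

Definition translation (g : G) : sym (assignment * G) :=
  fiberwise (fun=> lmul g).

Definition twist (p : constraint) : sym (assignment * G) :=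
  fiberwise (fun c => sval c p).

Lemma translationM : {morph translation : g h / g * h}.
Proof.
by move=> g h; apply: symP => y; rewrite symM; congr (_, _); rewrite /= mulgA.
Qed.

Lemma translation_inj : injective translation.
Proof.
move=> g h /(congr1 (fun s : sym _ => (s (exists_assignment, 1)).2)) /=.
by rewrite !mulg1.
Qed.

Lemma push_translation f g : translation g ^ (push f)^-1 = translation (f g).
Proof.
rewrite (conjgVE (_ : sym _)); apply: (canLR (mulgK _)); apply: symP => y.
by rewrite !symM; congr (_, _); rewrite /= gautM.
Qed.

Lemma push_twist f p : twist p ^ (push f)^-1 = twist (gaut_constraint f p).
Proof.
rewrite (conjgVE (_ : sym _)); apply: (canLR (mulgK _)); apply: symP => y.
rewrite !symM; congr (_, _).
rewrite -[RHS]/(transport f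
  (sval y.1 (gaut_constraint f^-1 (gaut_constraint f p))) (f y.2)).
by rewrite -gaut_constraintM mulVg gaut_constraint1 transportE.
Qed.

End Twists.

(** * Extending a group so that its finite partial isomorphisms are inner *)

Lemma gaut_action (L K : groupType) (act : L -> K -> K) :
  (forall x, act 1 x = x) ->
  (forall a b x, act (a * b) x = act a (act b x)) ->
  (forall a, {morph act a : x y / x * y}) ->
  exists E : {multiplicative L -> gaut K}, forall a x, E a x = act a x.
Proof.
move=> act1 actM actG.
have autP a : `[< {morph act a : x y / x * y} /\ bijective (act a) >].
  apply/asboolP; split=> //; exists (act a^-1) => x.
    by rewrite -actM mulVg act1.
  by rewrite -actM mulgV act1.
have EM : {morph (fun a => GAut (autP a)) : a b / a * b}.
  by move=> a b; apply: gautP => x; exact: actM.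
by exists (morphism_of EM).
Qed.

Lemma gaut_conjugation (P L : groupType) (A : groupClosed P)
    (rho : {multiplicative L -> P}) :
  (forall a k, k \in A -> k ^ (rho a)^-1 \in A) ->
  exists E : {multiplicative L -> gaut (subgroup A)},
    forall a k, val (E a k) = val k ^ (rho a)^-1.
Proof.
move=> rhoA.
pose act a (k : subgroup A) : subgroup A :=
  Sub (val k ^ (rho a)^-1) (rhoA a (val k) (valP k)).
have [|||E EP] := @gaut_action L (subgroup A) act.
- by move=> k; apply: val_inj; rewrite /= mulf1 invg1 conjg1.
- by move=> a b k; apply: val_inj; rewrite /= gmulfM invgM conjgM.
- by move=> a k l; apply: val_inj; exact: conjMg.
by exists E => a k; rewrite EP.
Qed.

Lemma generated_conj (P : groupType) (A : groupClosed P) (S : set P) (t : P) :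
  [set` A] = Defs.generated S -> (forall s, S s -> s ^ t \in A) ->
  forall k, k \in A -> k ^ t \in A.
Proof.
move=> AS SA k kA.
have [|||B BE] := @groupClosedP P [set x | x ^ t \in A].
- by rewrite /= conj1g gpred1.
- by move=> x y /= xA yA; rewrite conjMg gpredM.
- by move=> x /= xA; rewrite conjVg gpredVr.
have : Defs.generated S k by rewrite -AS.
have SB : S `<=` [set` B] by rewrite BE.
by move/(generated_min SB); rewrite BE.
Qed.

Lemma locally_finite_subgroup (P : groupType) (A : groupClosed P) :
  (forall s : seq P, {in s, forall x, x \in A} ->
    exists B : groupClosed P,
      {in s, forall x, x \in B} /\ finite_set [set` B]) ->
  locally_finite (subgroup A).
Proof.
move=> fin S /finite_seqP[s ->].
have [_ /mapP[x _ ->]|B [sB Bfin]] := fin [seq val x | x <- s].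
  exact: valP.
have [|||C CE] := @groupClosedP (subgroup A) [set x | val x \in B].
- by rewrite /= gpred1.
- by move=> x y /= xB yB; rewrite gpredM.
- by move=> x /= xB; rewrite gpredVr.
apply: (@sub_finite_set _ _ [set` C]).
  by apply: generated_min; rewrite CE => x xs; apply: sB; exact: map_f.
rewrite CE; apply: (finite_preimage (f := val) (B := [set` B])) => //.
by move=> x y _ _; exact: val_inj.
Qed.

Section ConjugatingExtension.
Variable G : groupType.
Hypotheses (countG : countable [set: G]) (lfG : locally_finite G).

Let generators : set (sym (assignment G * G)) :=
  range (@translation G) `|` range (@twist G).

Let countable_generators : countable generators.
Proof.
have /countable_injP[f finj0] := countG.
have finj : injective f by move=> x y; apply: finj0; rewrite in_setT.
pose f2 (q : G * G) := (f q.1, f q.2).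
have f2inj : injective f2 by move=> [a b] [c d] [/finj-> /finj->].
pose gen (z : G + constraint G) :=
  match z with inl g => translation g | inr p => twist p end.
pose code (z : G + constraint G) : nat + seq (nat * nat) * seq nat :=
  match z with inl g => inl (f g) | inr p => inr (map f2 p.1, map f p.2) end.
have codeinj : injective code.
  move=> [g|[p1 p2]] [h|[q1 q2]] //= [] => [/finj-> //|].
  by move=> /(inj_map f2inj)-> /(inj_map finj)->.
have gens : generators `<=` range gen.
  by move=> _ [[g _ <-]|[p _ <-]]; [exists (inl g) | exists (inr p)].
apply: sub_countable (subset_card_le gens) _.
apply: sub_countable (card_image_le _ _) _.
apply/countable_injP; exists (pickle \o code) => x y _ _.
exact: inj_comp (pcan_inj pickleK) codeinj _ _.
Qed.

(** The witness s is a list rather than a finite subgroup, so that products are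
    handled by concatenation; the displacement of k then lies in every finite
    subgroup containing s, whatever the point. *)
Let bounded (k : sym (assignment G * G)) : Prop :=
  exists s : seq G, forall (F : finGroupType) (e : {multiplicative F -> G}),
    {in s, forall x, exists a, e a = x} ->
    forall y, exists a, k y = (y.1, e a * y.2).

Lemma generated_bounded k : Defs.generated generators k -> bounded k.
Proof.
have [|||A AE] := @groupClosedP _ bounded.
- by exists [::] => F e _ [c x]; exists 1; rewrite mulf1 mul1g.
- move=> k1 k2 [s1 b1] [s2 b2]; exists (s1 ++ s2) => F e es y.
  have [|a2 E2] := b2 F e _ y.
    by move=> x xs; apply: es; rewrite mem_cat xs orbT.
  have [|a1 E1] := b1 F e _ (k2 y).
    by move=> x xs; apply: es; rewrite mem_cat xs.
  by exists (a1 * a2); rewrite symM E1 E2 gmulfM mulgA.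
- move=> {}k [s b]; exists s => F e es y.
  move: (b F e es (k^-1 y)); rewrite symVK; case: (k^-1 y) => c x [a ->].
  by exists a^-1; rewrite /= mulfV mulKg.
rewrite -AE; apply: generated_min; rewrite AE => _ [[g _ <-]|[p _ <-]].
  exists [:: g] => F e es [c x]; have [a ea] := es g (mem_head _ _).
  by exists a; rewrite ea.
exists (1 :: p.2) => F e es [c x] /=.
have [a ea] : exists a, e a = (sval c p x) * x^-1.
  apply: es; rewrite inE; case: (proj2_sig c p) => [[-> _]|[-> _]].
    by rewrite orbT.
  by rewrite sym1 mulgV eqxx.
by exists a; congr (_, _); rewrite ea mulgVK.
Qed.

(** K is generated by the translations and the twists. It is countable, having
    countably many generators, and locally finite since its elements are
    bounded. Aut(G) acts by conjugation with push, and for u and v as in the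
    last clause, the twist for the constraint that maps u to v conjugates
    translation by u a to translation by v a: that constraint is satisfiable, so
    every system of choices satisfies it. *)
Lemma conjugating_extension :
  exists (K : groupType) (i : {multiplicative G -> K})
         (E : {multiplicative gaut G -> gaut K}),
    [/\ countable [set: K] /\ locally_finite K, injective i,
        forall f x, E f (i x) = i (f x) &
        forall (A : finGroupType) (u v : {multiplicative A -> G}),
          injective u -> injective v ->
          exists t, forall a, i (u a) ^ t = i (v a)].
Proof.
have [A AE] := generated_closed generators.
have genA s : generators s -> s \in A.
  by move=> gs; have /= : [set` A] s by rewrite AE => B; apply.
have trA g : translation g \in A by apply: genA; left; exists g.
have twA p : twist p \in A by apply: genA; right; exists p.
pose i0 g : subgroup A := Sub (translation g) (trA g).
have i0M : {morph i0 : x y / x * y} by move=> x y; apply/val_inj/translationM.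
have [|E EP] := @gaut_conjugation _ _ A (morphism_of (@pushM G)).
  move=> f; apply: (generated_conj AE) => _ [[g _ <-]|[p _ <-]].
    by rewrite [morphism_of _ f]/= push_translation.
  by rewrite [morphism_of _ f]/= push_twist.
exists (subgroup A), (morphism_of i0M), E; split; first split.
- have := countable_generated countable_generators; rewrite -AE.
  move=> /countable_injP[f finj]; apply/countable_injP; exists (f \o val).
  move=> x y _ _ /= fxy; apply: val_inj; apply: finj => //.
    by rewrite inE; exact: valP.
  by rewrite inE; exact: valP.
- apply: locally_finite_subgroup => ks ksA.
  have /choice[s sP] (k : subgroup A) : bounded (val k).
    by apply: generated_bounded; rewrite -AE; exact: valP.
  pose kk : seq (subgroup A) := pmap insub ks.
  have /locally_finiteP/(_ (flatten (map s kk)))[F [e [_ es]]] := lfG.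
  pose act (a : F) (y : assignment G * G) := (y.1, e a * y.2).
  have [||||B [kB Bfin]] := @bounded_generate_finite F _ act _ _ [set` ks].
  + by case=> c x; rewrite /act mulf1 mul1g.
  + by move=> a b y; rewrite /act gmulfM mulgA.
  + exact: finite_seq.
  + move=> k /= kks; apply: (sP (Sub k (ksA k kks))) => x xs.
    apply/es/flattenP; exists (s (Sub k (ksA k kks))) => //.
    apply: map_f; by rewrite mem_pmap_sub.
  by exists B; split=> // k; exact: kB.
- by move=> x y /(congr1 val)/translation_inj.
- by move=> f x; apply: val_inj; rewrite EP; exact: push_translation.
- move=> C u v uinj vinj.
  have /locally_finiteP/(_ ([seq u a | a <- enum C] ++ [seq v a | a <- enum C]))
    [F [e [einj es]]] := lfG.
  have [||s [[s' sK s'K] se suv]] := coset_equivariant_bijection einj uinj vinj.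
  + by move=> a; apply: es; rewrite mem_cat map_f // mem_enum.
  + by move=> a; apply: es; rewrite mem_cat orbC map_f // mem_enum.
  pose p : constraint G :=
    ([seq (u a, v a) | a <- enum C], [seq e b | b <- enum F]).
  have sat : satisfies p (mksym sK s'K).
    split=> [x|q /mapP[a _ ->] x]; last exact: suv.
    have [b bx] := se x; have /= -> := bx; rewrite mulgK.
    by apply: map_f; rewrite mem_enum.
  exists (Sub (twist p) (twA p))^-1 => a; apply: val_inj.
  rewrite [LHS](_ : _ = translation (u a) ^ (twist p)^-1) //.
  rewrite (conjgVE (_ : sym _)); apply: (canLR (mulgK _)).
  apply: symP => -[c x].
  rewrite !symM; congr (_, _).
  case: (proj2_sig c p) => [[_ cp]|[_ []]]; last by exists (mksym sK s'K).
  by apply: (cp (u a, v a)); rewrite map_f // mem_enum.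
Qed.

End ConjugatingExtension.

(** * Unions of chains of groups *)

(** Prescribing only the value at N leaves the earlier terms free, which avoids
    any composite map from G N to G n. The induction shifts the whole chain. *)
Lemma coherent_sequence (G : nat -> groupType)
    (i : forall n, {multiplicative G n -> G n.+1}) N (g : G N) :
  exists x : forall n, G n,
    x N = g /\ forall n, N <= n -> x n.+1 = i n (x n).
Proof.
elim: N G i g => [|N IH] G i g.
  by exists (fix x n : G n := if n is m.+1 then i m (x m) else g).
have [x [xN xi]] := IH (fun n => G n.+1) (fun n => i n.+1) g.
exists (fun n => if n is m.+1 then x m else 1); split=> // -[|n] //.
exact: xi.
Qed.

Section DirectLimit.
Variables (G : nat -> groupType) (i : forall n, {multiplicative G n -> G n.+1}).
Hypothesis iinj : forall n, injective (i n).

(** The limit consists of the sequences that are eventually coherent, modulo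
    eventual equality; a class is represented by a canonical element rep x. *)
Let T : choiceType := {classic forall n, G n}.
Let at_ (x : T) n : G n := x n.
Let coherent (x : T) : Prop :=
  exists N, forall n, N <= n -> at_ x n.+1 = i n (at_ x n).
Let eventually_eq (x y : T) : Prop :=
  exists N, forall n, N <= n -> at_ x n = at_ y n.
Let rep (x : T) : T := xget (fun=> 1) [set y | eventually_eq x y].

Let ee_refl x : eventually_eq x x. Proof. by exists 0. Qed.
Let ee_sym x y : eventually_eq x y -> eventually_eq y x.
Proof. by move=> [N xy]; exists N => n /xy. Qed.
Let ee_trans y x z :
  eventually_eq x y -> eventually_eq y z -> eventually_eq x z.
Proof.
move=> [N xy] [M yz]; exists (maxn N M) => n; rewrite geq_max => /andP[Nn Mn].
by rewrite xy // yz.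
Qed.

Let repP x : eventually_eq x (rep x).
Proof.
by apply: (@xgetPex _ _ [set y | eventually_eq x y]); exists x; exact: ee_refl.
Qed.

Let rep_eq x y : eventually_eq x y -> rep x = rep y.
Proof.
move=> xy; congr (xget _ _); apply/seteqP; split=> z /=; apply: ee_trans => //.
exact: ee_sym.
Qed.

Let repK x : rep (rep x) = rep x.
Proof. exact/rep_eq/ee_sym/repP. Qed.

Let coherent_ee x y : eventually_eq x y -> coherent x -> coherent y.
Proof.
move=> [N xy] [M cx]; exists (maxn N M) => n; rewrite geq_max => /andP[Nn Mn].
by rewrite -!xy ?cx // leqW.
Qed.

Let L : Type := {x : T | `[< coherent x /\ rep x = x >]}.

Let mk x (cx : coherent x) : L :=
  Sub (rep x) (introT (asboolP _) (conj (coherent_ee (repP x) cx) (repK x))).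

Let LP (l : L) : coherent (val l).
Proof. by have /asboolP[] := valP l. Qed.

Let mkP x (cx : coherent x) y (cy : coherent y) :
  eventually_eq x y -> mk cx = mk cy.
Proof. by move=> xy; apply/val_inj/rep_eq. Qed.

Let mkK x (cx : coherent x) y (cy : coherent y) :
  mk cx = mk cy -> eventually_eq x y.
Proof.
move=> /(congr1 val) /= E; apply: ee_trans (repP x) _.
by rewrite E; apply/ee_sym/repP.
Qed.

Let val_mk x (cx : coherent x) : eventually_eq (val (mk cx)) x.
Proof. exact/ee_sym/repP. Qed.

Let mk_val (l : L) (cl : coherent (val l)) : mk cl = l.
Proof. by apply: val_inj => /=; have /asboolP[] := valP l. Qed.

Let mulT (x y : T) : T := fun n => at_ x n * at_ y n.
Let invT (x : T) : T := fun n => (at_ x n)^-1.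
Let oneT : T := fun n => 1.

Let coh_mul x y : coherent x -> coherent y -> coherent (mulT x y).
Proof.
move=> [N cx] [M cy]; exists (maxn N M) => n; rewrite geq_max => /andP[Nn Mn].
by rewrite /at_ /mulT cx // cy // gmulfM.
Qed.
Let coh_inv x : coherent x -> coherent (invT x).
Proof. by move=> [N cx]; exists N => n Nn; rewrite /at_ /invT cx // mulfV. Qed.
Let coh_one : coherent oneT.
Proof. by exists 0 => n _; rewrite /at_ /oneT mulf1. Qed.

Let ee_mul x y x' y' : eventually_eq x x' -> eventually_eq y y' ->
  eventually_eq (mulT x y) (mulT x' y').
Proof.
move=> [N cx] [M cy]; exists (maxn N M) => n; rewrite geq_max => /andP[Nn Mn].
by rewrite /at_ /mulT cx // cy.
Qed.
Let ee_inv x x' : eventually_eq x x' -> eventually_eq (invT x) (invT x').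
Proof. by move=> [N cx]; exists N => n Nn; rewrite /at_ /invT cx. Qed.

Let mul (k l : L) : L := mk (coh_mul (LP k) (LP l)).
Let inv (k : L) : L := mk (coh_inv (LP k)).
Let one : L := mk coh_one.

Let mul_mk x cx y cy : mul (@mk x cx) (@mk y cy) = mk (coh_mul cx cy).
Proof. by apply: mkP; apply: ee_mul; exact: val_mk. Qed.

Let inv_mk x cx : inv (@mk x cx) = mk (coh_inv cx).
Proof. by apply: mkP; apply: ee_inv; exact: val_mk. Qed.

Let mk_ext x cx y cy : (forall n, at_ x n = at_ y n) -> @mk x cx = @mk y cy.
Proof. by move=> xy; apply: mkP; exists 0. Qed.

Let mulA : associative mul.
Proof.
move=> a b c.
rewrite -(mk_val (LP a)) -(mk_val (LP b)) -(mk_val (LP c)) !mul_mk.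
by apply: mk_ext => n; apply: mulgA.
Qed.
Let mul1 : left_id one mul.
Proof.
by move=> a; rewrite -(mk_val (LP a)) mul_mk; apply: mk_ext => n; apply: mul1g.
Qed.
Let mulr1 : right_id one mul.
Proof.
by move=> a; rewrite -(mk_val (LP a)) mul_mk; apply: mk_ext => n; apply: mulg1.
Qed.
Let mulV : left_inverse one inv mul.
Proof.
move=> a; rewrite -(mk_val (LP a)) inv_mk mul_mk.
by apply: mk_ext => n; apply: mulVg.
Qed.
Let mulrV : right_inverse one inv mul.
Proof.
move=> a; rewrite -(mk_val (LP a)) inv_mk mul_mk.
by apply: mk_ext => n; apply: mulgV.
Qed.

Let from N (x : T) := forall n, N <= n -> at_ x n.+1 = i n (at_ x n).

(** By injectivity, agreement of two sequences at one late index spreads both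
    forward and backward. *)
Let from_eq N x y n : from N x -> from N y -> N <= n ->
  (at_ x n = at_ y n <-> at_ x N = at_ y N).
Proof.
move=> xi yi; elim: n => [|n IH]; first by rewrite leqn0 => /eqP ->.
rewrite leq_eqVlt ltnS => /orP[/eqP <- //|Nn].
by rewrite -(IH Nn) xi // yi //; split=> [/iinj|->].
Qed.

Lemma direct_limit :
  exists (L : groupType) (j : forall n, {multiplicative G n -> L}),
    [/\ forall n, injective (j n), forall n x, j n.+1 (i n x) = j n x &
        forall l, exists n x, l = j n x].
Proof.
pose C : choiceType := {classic L}.
pose LL : groupType := HB.pack_for groupType C
  (isGroup.Build C mulA mul1 mulr1 mulV mulrV).
pose x_ (N : nat) (g : G N) : T := projT1 (cid (coherent_sequence i g)).
have xN N (g : G N) : at_ (x_ N g) N = g by rewrite /x_; case: cid => x /= [].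
have xF N (g : G N) : from N (x_ N g) by rewrite /x_; case: cid => x /= [].
have xC N (g : G N) : coherent (x_ N g) by exists N; exact: xF.
pose j N (g : G N) : LL := mk (xC N g).
have jE N (x : T) (cx : coherent x) (g : G N) :
    from N x -> at_ x N = g -> mk cx = j N g.
  move=> xi xg; apply: mkP; exists N => n Nn.
  by apply/(from_eq xi (xF N g) Nn); rewrite xN.
have jM N : {morph j N : g h / g * h}.
  move=> g h; rewrite [RHS]mul_mk; apply/esym/jE; last first.
    by rewrite /at_ /mulT !xN.
  by move=> n Nn; rewrite /at_ /mulT !(xF N) // gmulfM.
exists LL, (fun n => morphism_of (jM n)); split=> [N g h /mkK[M gh]|N g|l].
- have le := leq_maxl N M; 
  rewrite -(xN N g) -(xN N h).
  exact/(from_eq (xF N g) (xF N h) le)/gh/leq_maxr.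
- apply/esym/jE; last by rewrite xF ?xN.
  by move=> n Nn; apply: xF; exact: ltnW.
- have [N lN] := LP l; exists N, (at_ (val l) N).
  by rewrite -[LHS](mk_val (LP l)); exact: jE.
Qed.
End DirectLimit.

Section UnionOfChain.
Variables (G : nat -> groupType) (i : forall n, {multiplicative G n -> G n.+1}).
Variables (X : groupType) (j : forall n, {multiplicative G n -> X}).
Hypothesis jinj : forall n, injective (j n).
Hypothesis ji : forall n x, j n.+1 (i n x) = j n x.
Hypothesis j_onto : forall l, exists n x, l = j n x.

Lemma chain_lift n m x : n <= m -> exists y, j m y = j n x.
Proof.
elim: m => [|m IH]; first by rewrite leqn0 => /eqP nE; subst n; exists x.
rewrite leq_eqVlt ltnS => /orP[/eqP nE|/IH[y <-]]; first by subst n; exists x.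
by exists (i m y).
Qed.

(** Finitely many elements of a union of a chain lie in one of its members;
    through this, each of the properties below passes to the union. *)
Lemma chain_level (s : seq X) :
  exists n, {in s, forall l, exists x, j n x = l}.
Proof.
elim: s => [|l s [n sn]]; first by exists 0.
have [m [y ly]] := j_onto l.
exists (maxn n m) => k; rewrite inE => /orP[/eqP ->|/sn[x <-]].
  by rewrite ly; apply: chain_lift; rewrite leq_maxr.
by apply: chain_lift; rewrite leq_maxl.
Qed.

Lemma chain_countable : (forall n, countable [set: G n]) -> countable [set: X].
Proof.
move=> cG.
have -> : [set: X] = \bigcup_n range (j n).
  apply/seteqP; split=> // l _; have [n [x ->]] := j_onto l.
  by exists n => //; exists x.
apply: bigcup_countable => // n _.
exact: sub_countable (card_image_le _ _) (cG n).
Qed.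

Lemma chain_locally_finite :
  (forall n, locally_finite (G n)) -> locally_finite X.
Proof.
move=> lfG; apply/locally_finiteP => s; have [n sn] := chain_level s.
have /choice[x_ xE] (l : X) : exists x, l \in s -> j n x = l.
  by have [/sn[x <-]|_] := boolP (l \in s); [exists x | exists 1].
have /locally_finiteP/(_ (map x_ s))[F [e [einj es]]] := lfG n.
exists F, (j n \o e); split; first exact: inj_comp (@jinj n) einj.
move=> l ls; have [a ea] := es (x_ l) (map_f _ ls).
by exists a; rewrite /= ea xE.
Qed.

(** Two embeddings of a finite group land in a common member of the chain, and
    are conjugate in the next one. *)
Lemma chain_homogeneous :
  (forall n (A : finGroupType) (u v : {multiplicative A -> G n}),
     injective u -> injective v ->
     exists t, forall a, i n (u a) ^ t = i n (v a)) ->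
  homogeneous X.
Proof.
move=> conjG A u v uinj vinj.
have [n uvn] :=
  chain_level ([seq u a | a <- enum A] ++ [seq v a | a <- enum A]).
have [|u' uE] := @factor_through _ _ _ u (j n) (@jinj n).
  by move=> a; apply: uvn; rewrite mem_cat map_f // mem_enum.
have [|v' vE] := @factor_through _ _ _ v (j n) (@jinj n).
  by move=> a; apply: uvn; rewrite mem_cat orbC map_f // mem_enum.
have [t tE] := conjG n A u' v' (factor_inj uinj uE) (factor_inj vinj vE).
by exists (j n.+1 t) => a; rewrite -uE -vE -(ji (u' a)) -(ji (v' a)) -mulfJ tE.
Qed.

Lemma chain_action (L : groupType)
    (E : forall n, {multiplicative L -> gaut (G n)}) :
  (forall n f x, E n.+1 f (i n x) = i n (E n f x)) ->
  exists EX : {multiplicative L -> gaut X},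
    forall n f x, EX f (j n x) = j n (E n f x).
Proof.
move=> Ei.
have lift n m x : n <= m ->
    exists y, j m y = j n x /\ forall f, j m (E m f y) = j n (E n f x).
  elim: m => [|m IH]; first by rewrite leqn0 => /eqP nE; subst n; exists x.
  rewrite leq_eqVlt ltnS => /orP[/eqP nE|/IH[y [yx yf]]].
    by subst n; exists x.
  by exists (i m y); rewrite ji; split=> // f; rewrite Ei ji.
have wd n m x y f : j n x = j m y -> j n (E n f x) = j m (E m f y).
  wlog nm : n m x y / n <= m => [th|xy].
    have [/th|/ltnW/th th' xy] := leqP n m; first exact.
    exact/esym/th'/esym.
  have [z [zx zf]] := lift n m x nm.
  by rewrite -zf (@jinj m z y) // zx.
have /choice[act actP] (p : L * X) :
    exists l, forall n x, p.2 = j n x -> l = j n (E n p.1 x).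
  have [n [x px]] := j_onto p.2; exists (j n (E n p.1 x)) => m y py.
  by apply: wd; rewrite -px.
have actE f n x : act (f, j n x) = j n (E n f x) by exact: actP.
have [|||EX EXP] := @gaut_action L X (fun f l => act (f, l)).
- by move=> l; have [n [x ->]] := j_onto l; rewrite actE (mulf1 (E n)).
- by move=> f g l; have [n [x ->]] := j_onto l; rewrite !actE gmulfM.
- move=> f k l; have [n kl] := chain_level [:: k; l].
  have [x <-] := kl k (mem_head _ _).
  have [|y <-] := kl l; first by rewrite !inE eqxx orbT.
  by rewrite -gmulfM !actE gautM gmulfM.
by exists EX => n f x; rewrite EXP actE.
Qed.

End UnionOfChain.

(** * Equivariant embedding into Hall's group *)

(** The acting group L stays fixed along the chain, so that each automorphism
    of the initial group acts compatibly on all members. *)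
Record equivariant_group (L : groupType) : Type := EquivariantGroup {
  eq_group :> groupType;
  eq_action : {multiplicative L -> gaut eq_group};
  eq_countable : countable [set: eq_group];
  eq_locally_finite : locally_finite eq_group }.

Definition conjugating_embedding (L : groupType) (S T : equivariant_group L)
    (i : {multiplicative S -> T}) : Prop :=
  [/\ injective i,
      forall f x, eq_action T f (i x) = i (eq_action S f x) &
      forall (A : finGroupType) (u v : {multiplicative A -> S}),
        injective u -> injective v ->
        exists t, forall a, i (u a) ^ t = i (v a)].

Lemma equivariant_step (L : groupType) (S : equivariant_group L) :
  exists (T : equivariant_group L) (i : {multiplicative S -> T}),
    conjugating_embedding i.
Proof.
have [K [i [E [[cK lK] iinj Ei homK]]]] :=
  conjugating_extension (eq_countable S) (@eq_locally_finite _ S).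
exists (@EquivariantGroup L K (E \o eq_action S) cK lK), i.
by split=> // f x; exact: Ei.
Qed.

Lemma equivariant_homogeneous (L : groupType) (S : equivariant_group L) :
  exists (T : equivariant_group L) (i : {multiplicative S -> T}),
    [/\ injective i, forall f x, eq_action T f (i x) = i (eq_action S f x) &
        homogeneous T].
Proof.
have /choice[next nextP] := @equivariant_step L.
pose chain := fix chain n := if n is m.+1 then next (chain m) else S.
pose i n : {multiplicative chain n -> chain n.+1} :=
  projT1 (cid (nextP (chain n))).
have iP n : conjugating_embedding (i n) := projT2 (cid (nextP (chain n))).
have iinj n : injective (i n) by have [] := iP n.
have [X [j [jinj ji j_onto]]] := @direct_limit chain i iinj.
have [|E EP] := @chain_action chain i X j jinj ji j_onto L
    (fun n => eq_action (chain n)).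
  by move=> n; have [] := iP n.
have cX := chain_countable j_onto (fun n => eq_countable (chain n)).
have lX := chain_locally_finite jinj ji j_onto
    (fun n => @eq_locally_finite _ (chain n)).
exists (EquivariantGroup E cX lX), (j 0); split=> [|f x|].
  exact: (jinj 0).
  exact: (EP 0).
apply: (chain_homogeneous jinj ji j_onto) => n A u v uinj vinj.
by have [_ _] := iP n; apply.
Qed.

Lemma locally_finite_prod (G K : groupType) :
  locally_finite G -> locally_finite K -> locally_finite (G * K)%type.
Proof.
move=> /locally_finiteP lG /locally_finiteP lK; apply/locally_finiteP => s.
have [F [e [einj es]]] := lG (map fst s).
have [F' [e' [e'inj es']]] := lK (map snd s).
pose h (p : F * F') : G * K := (e p.1, e' p.2).
have hM : {morph h : x y / x * y} by move=> x y; rewrite /h !gmulfM.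
exists (F * F')%type, (morphism_of hM).
split=> [[a b] [c d] [/einj -> /e'inj ->] //|p ps].
have [a ea] := es _ (map_f fst ps); have [b eb] := es' _ (map_f snd ps).
by exists (a, b); rewrite /= /h ea eb -surjective_pairing.
Qed.

(** Starting the chain from G x H, with Aut(G) acting on the first factor, makes
    every finite group embed into the resulting group T, so that T is isomorphic
    to H. *)
Lemma hall_equivariant_embedding (H G : groupType) :
  is_hall_universal H -> countable [set: G] -> locally_finite G ->
  exists (j : {multiplicative G -> H}) (E : {multiplicative gaut G -> gaut H}),
    injective j /\ forall f x, E f (j x) = j (f x).
Proof.
move=> hallH cG lG.
have [cH lH eH _] := hallH.
pose act (f : gaut G) (p : G * H) := (f p.1, p.2).
have [|||E EP] := @gaut_action (gaut G) (G * H)%type act.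
- by case.
- by [].
- by move=> f x y; rewrite /act gautM.
have cGH : countable [set: G * H] by rewrite -setXTT; exact: countableX.
pose S := EquivariantGroup E cGH (locally_finite_prod lG lH).
have [T [i [iinj Ei homT]]] := equivariant_homogeneous S.
have inG : {morph (fun x : G => (x, 1 : H)) : x y / x * y}.
  by move=> x y; congr (_, _); rewrite mulg1.
have inH : {morph (fun x : H => (1 : G, x)) : x y / x * y}.
  by move=> x y; congr (_, _); rewrite mulg1.
have embT (K : finGroupType) : embeds K T.
  have [z zinj] := eH K; exists (i \o (morphism_of inH \o z)).
  by move=> x y /= /iinj[] /zinj.
have [h [h' hK h'K]] : isomorphic T H.
  apply: back_and_forth => //; last exact: hall_homogeneous.
    exact: eq_countable.
  exact: eq_locally_finite.
have [|||EH EHP] :=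
  @gaut_action (gaut G) H (fun f x => h (eq_action T f (h' x))).
- by move=> x; rewrite (mulf1 (eq_action T)) h'K.
- by move=> f g x; rewrite hK gmulfM.
- by move=> f x y; rewrite (can2_gmulfM hK h'K) gautM gmulfM.
exists (h \o (i \o morphism_of inG)), EH.
split=> [x y /= /(can_inj hK)/iinj[] //|f x].
by rewrite EHP /= hK Ei /= EP.
Qed.

Theorem theorem4 (H : groupType) (hallH : is_hall_universal H)
    (G : groupType) (countG : countable [set: G]) (lfG : locally_finite G) :
  exists G' : groupClosed H,
    isomorphic (subgroup G') G /\
    exists ext : {multiplicative gaut (subgroup G') -> gaut H},
      (forall (f : gaut (subgroup G')) (x : subgroup G'),
         ext f (val x) = val (f x)) /\
      injective ext.
Proof.
have [j [E [jinj jE]]] := hall_equivariant_embedding hallH countG lfG.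
have [G' G'E] := range_closed j.
have [k [[k' kK k'K] kj]] := corestriction jinj G'E.
exists G'; split.
  by exists (morphism_of (can2_gmulfM kK k'K)); exists k.
have [|||C CP] := @gaut_action (gaut (subgroup G')) G (fun f x => k' (f (k x))).
- by move=> x; exact: kK.
- by move=> f g x; rewrite k'K.
- by move=> f x y; rewrite gmulfM gautM (can2_gmulfM kK k'K).
have extP f x : E (C f) (val x) = val (f x).
  by rewrite -[x]k'K kj jE CP k'K -kj k'K.
exists (E \o C); split=> [//|f g fg]; apply: gautP => x.
by apply: val_inj; rewrite -!extP -[E (C f)]/((E \o C) f) fg.
Qed.
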